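(* In the class of all graphs, countability is expressible in the modal language of graph theory: there is a sentence $\sigma\in\mathcal{L}_\sim^{\Diamond}$ such that for every graph $G$, $$G\models\sigma\quad\text{if and only if}\quad G\text{ is countable}.$$
   Context: Countable means finite or countably infinite. A graph is a set of vertices (of any cardinality) together with an irreflexive symmetric binary edge relation $\sim$. $\mathcal{L}_\sim$ is the first-order language (with equality) whose only non-logical symbol is the binary relation symbol $\sim$. $\mathcal{L}_\sim^{\Diamond}$ is the full first-order modal language, closing $\mathcal{L}_\sim$ under the modal operators $\Diamond,\Box$, Boolean connectives and quantifiers. Formulas are evaluated at graphs, within the class of all graphs under the substructure relation: $G\models\Diamond\varphi[\bar a]$ iff there is a graph $H$ containing $G$ as a substructure (i.e. $G$ is an induced subgraph of $H$) with $H\models\varphi[\bar a]$; $G\models\Box\varphi[\bar a]$ iff $H\models\varphi[\bar a]$ for every graph $H$ containing $G$ as a substructure; Boolean connectives and quantifiers are interpreted as usual, with quantifiers ranging over the vertices of the graph at which the formula is evaluated. *)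

(* Defs.v *)
From mathcomp Require Import all_boot.
From mathcomp Require Import boolp classical_sets functions cardinality.

Set Implicit Arguments.
Unset Strict Implicit.
Unset Printing Implicit Defensive.

Record graph := Graph {
  vertex :> Type;
  adj : vertex -> vertex -> Prop;
  adj_irrefl : forall x, ~ adj x x;
  adj_sym : forall x y, adj x y -> adj y x }.

(* "G is a substructure (an induced subgraph) of H", up to the renaming of the
   vertices of G by f. Truth is invariant under isomorphism, so letting H range
   over the graphs into which G embeds amounts to letting it range over those
   which literally contain G. *)
Definition embedding (G H : graph) (f : G -> H) : Prop :=
  injective f /\ forall x y : G, adj (f x) (f y) <-> adj x y.

(* [form n] is the set of formulas whose free variables are among n variables,
   in well-scoped de Bruijn style: a quantifier binds variable 0 of its body and
   the free variables of the quantified formula are shifted by one. In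
   particular sentences can be evaluated at the empty graph. *)
Inductive form : nat -> Type :=
| Feq n of 'I_n & 'I_n : form n
| Fadj n of 'I_n & 'I_n : form n
| Fnot n of form n : form n
| Fand n of form n & form n : form n
| For n of form n & form n : form n
| Fimp n of form n & form n : form n
| Fex n of form n.+1 : form n
| Fall n of form n.+1 : form n
| Fdia n of form n : form n
| Fbox n of form n : form n.

Definition sentence := form 0.

Fixpoint sat n (phi : form n) (G : graph) : n.-tuple G -> Prop :=
  match phi in form n return n.-tuple G -> Prop with
  | Feq _ i j => fun a => tnth a i = tnth a j
  | Fadj _ i j => fun a => adj (tnth a i) (tnth a j)
  | Fnot _ p => fun a => ~ sat p a
  | Fand _ p q => fun a => sat p a /\ sat q a
  | For _ p q => fun a => sat p a \/ sat q a
  | Fimp _ p q => fun a => sat p a -> sat q a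
  | Fex _ p => fun a => exists x : G, sat p [tuple of x :: a]
  | Fall _ p => fun a => forall x : G, sat p [tuple of x :: a]
  | Fdia _ p => fun a =>
      exists (H : graph) (f : G -> H), embedding f /\ sat p [tuple of map f a]
  | Fbox _ p => fun a =>
      forall (H : graph) (f : G -> H), embedding f -> sat p [tuple of map f a]
  end.

Definition models (G : graph) (sigma : sentence) : Prop :=
  sat sigma ([tuple] : 0.-tuple G).

(* Main.v *)
(** A graph [G] is countable iff it is an induced subgraph of a graph [H] that is
    made up of a vertex [p], the set [R] of its neighbours, and further vertices,
    such that each vertex in [R] has at most three neighbours besides [p], each
    vertex except [p] has a neighbour in [R], and [R] induces a connected graph.
    Such an [H] is countable; conversely, for countable [G], take [R] to be a ray
    and attach the [n]-th vertex of [G] to the [n]-th vertex of the ray. All of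
    this is first order except for the connectedness of [R], which is modal: [R]
    is connected iff, in every extension, the neighbourhood of a vertex [c] that
    contains a given [r] in [R] and is closed under adjacency in [R] contains each
    vertex of the original [R]. *)
Require Import Defs.
From mathcomp Require Import all_boot.
From mathcomp Require Import boolp classical_sets functions cardinality.

Set Implicit Arguments.
Unset Strict Implicit.
Unset Printing Implicit Defensive.

Local Open Scope classical_set_scope.

(* The bidirectionality hints make the expected type fix the scope [n] before the
   bound in [#k] is checked by computation. *)
Arguments Ordinal {n} & m _.
Arguments Feq {n} & _ _.
Arguments Fadj {n} & _ _.
Arguments Fand {n} & _ _.
Arguments For {n} & _ _.
Arguments Fimp {n} & _ _.
Arguments Fex {n} & _.
Arguments Fall {n} & _.
Arguments Fbox {n} & _.

Local Notation "# k" := (@Ordinal _ k isT) (at level 0, k at level 0).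

Definition ray_like (H : graph) (p r : H) : Prop :=
  [/\ adj r p,
      forall u, adj u p -> exists a b d, forall v, adj v u ->
        v = p \/ v = a \/ v = b \/ v = d,
      forall s, adj s p ->
        forall (K : graph) (f : H -> K), embedding f -> forall c,
        adj c (f r) ->
        (forall u v, adj u (f p) -> adj v (f p) -> adj u c -> adj u v ->
          adj v c) ->
        adj (f s) c
    & forall x, x = p \/ exists u, adj u p /\ adj x u].

(* In the body, variables 0 and 1 stand for [r] and [p]. *)
Definition ray_like_form : form 2 :=
  Fand (Fadj #0 #1)
 (Fand (Fall (Fimp (Fadj #0 #2)
         (Fex (Fex (Fex (Fall (Fimp (Fadj #0 #4)
           (For (Feq #0 #6)
           (For (Feq #0 #3) (For (Feq #0 #2) (Feq #0 #1)))))))))))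
 (Fand (Fall (Fimp (Fadj #0 #2)
         (Fbox (Fall (Fimp (Fadj #0 #2)
           (Fimp (Fall (Fall (Fimp (Fadj #1 #5) (Fimp (Fadj #0 #5)
             (Fimp (Fadj #1 #2) (Fimp (Fadj #1 #0) (Fadj #0 #2)))))))
             (Fadj #1 #0)))))))
       (Fall (For (Feq #0 #2) (Fex (Fand (Fadj #0 #3) (Fadj #1 #0))))))).

Definition countable_sentence : sentence := Fdia (Fex (Fex ray_like_form)).

Lemma sat_ray_like_form (H : graph) (p r : H) (a : 0.-tuple H) :
  sat ray_like_form [tuple of r :: [tuple of p :: a]] <-> ray_like p r.
Proof.
rewrite /ray_like_form; cbn [sat]; rewrite /tnth /=.
by split=> [[? [? []]]|[]].
Qed.

Lemma models_countable_sentence (G : graph) :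
  models G countable_sentence <->
  exists (H : graph) (f : G -> H),
    embedding f /\ exists p r : H, ray_like p r.
Proof.
split=> -[H [f [fP [p [r rl]]]]]; exists H, f; split=> //; exists p, r.
- exact/sat_ray_like_form/rl.
- exact/sat_ray_like_form.
Qed.

Section AddVertex.
Variables (H : graph) (C : H -> Prop).

(** The new vertex [None] has neighbourhood [C], so that an arbitrary subset of [H] becomes
    definable from a parameter in an extension. *)
Definition add_vertex_adj (x y : option H) : Prop :=
  match x, y with
  | Some a, Some b => adj a b
  | Some a, None | None, Some a => C a
  | None, None => False
  end.

Lemma add_vertex_irrefl x : ~ add_vertex_adj x x.
Proof. by case: x => [a|] //=; apply: adj_irrefl. Qed.

Lemma add_vertex_sym x y : add_vertex_adj x y -> add_vertex_adj y x.
Proof. by case: x y => [a|] [b|] //=; apply: adj_sym. Qed.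

Definition add_vertex := Graph add_vertex_irrefl add_vertex_sym.

Lemma embedding_add_vertex : @embedding H add_vertex Some.
Proof. by split=> // x y [->]. Qed.

End AddVertex.

(** Extending [H] by a suitable vertex turns the modal clause into induction over the neighbours of
    [p]. *)
Lemma ray_like_reach (H : graph) (p r : H) (C : H -> Prop) :
  ray_like p r -> C r ->
  (forall u v, adj u p -> adj v p -> C u -> adj u v -> C v) ->
  forall s, adj s p -> C s.
Proof.
case=> rp _ conn _ Cr Cstep s sp.
(* Intersecting with [R] keeps the new vertex from entering [R]. *)
pose D x := adj x p /\ C x.
have [] // : D s.
apply: (conn s sp (add_vertex D) Some (embedding_add_vertex D) None) => //=.
case=> [u|] [v|] //= up vp; last by case: vp => /adj_irrefl.
by case=> _ Cu uv; split=> //; apply: Cstep Cu uv.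
Qed.

(** Each vertex ends a walk from [r] coded by a finite list of neighbour indices, and there are
    countably many such lists. *)
Lemma ray_like_countable (H : graph) (p r : H) :
  ray_like p r -> countable [set: H].
Proof.
move=> rl; have [rp deg _ dom] := rl.
have /choice[nbr nbrP] : forall u, exists l : seq H,
    adj u p -> forall v, adj v u -> exists i, v = nth p l i.
  move=> u; have [/deg[a [b [d abdP]]]|] := pselect (adj u p); last first.
    by exists [::].
  (* Index 3 is past the end of the list, where [nth] gives the default [p]. *)
  exists [:: a; b; d] => _ v /abdP[|[|[|]]] ->;
    by [exists 3 | exists 0 | exists 1 | exists 2].
pose walk := foldl (fun u i => nth p (nbr u) i) r.
have walk_step u v : adj u p -> adj v u ->
    (exists l, walk l = u) -> exists l, walk l = v.
  move=> up vu [l lu]; have [i ->] := nbrP u up v vu.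
  by exists (rcons l i); rewrite /walk foldl_rcons -/(walk l) lu.
have reach s (sp : adj s p) : exists l, walk l = s.
  apply: (ray_like_reach (C := fun s => exists l, walk l = s) rl) sp.
    by exists [::].
  by move=> u v up _ Cu uv; exact: walk_step up (adj_sym uv) Cu.
have surj x : exists l, walk l = x.
  have [->|[u [up xu]]] := dom x; last exact: walk_step up xu (reach u up).
  exact: walk_step rp (adj_sym rp) (reach r rp).
have /choice[code codeK] := surj.
apply/countable_injP; exists (pickle \o code).
move=> x y _ _ /= /(pcan_inj pickleK) xy.
by rewrite -(codeK x) xy codeK.
Qed.

Section AttachRay.
Variables (G : graph) (code : G -> nat).
Hypothesis code_inj : injective code.

(* [None] is the apex, [Some (inl n)] the ray and [Some (inr x)] the graph. *)
Definition attach_ray_adj (x y : option (nat + G)) : Prop :=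
  match x, y with
  | None, Some (inl _) | Some (inl _), None => True
  | Some (inl m), Some (inl n) => m = n.+1 \/ n = m.+1
  | Some (inl n), Some (inr a) | Some (inr a), Some (inl n) => code a = n
  | Some (inr a), Some (inr b) => adj a b
  | _, _ => False
  end.

Lemma attach_ray_irrefl x : ~ attach_ray_adj x x.
Proof.
case: x => [[n|a]|] //=; last exact: adj_irrefl.
by case=> /esym/eqP; rewrite (gtn_eqF (ltnSn n)).
Qed.

Lemma attach_ray_sym x y : attach_ray_adj x y -> attach_ray_adj y x.
Proof.
by case: x y => [[m|a]|] [[n|b]|] //=; [case; [right | left] | apply: adj_sym].
Qed.

Definition attach_ray := Graph attach_ray_irrefl attach_ray_sym.

Lemma embedding_attach_ray : @embedding G attach_ray (Some \o inr).
Proof. by split=> // x y [->]. Qed.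

Lemma attach_ray_ray_like : @ray_like attach_ray None (Some (inl 0)).
Proof.
split=> //=.
- case=> [[n|a]|] //= _.
  (* [d] is the vertex of [G] attached to [n], or a dummy if there is none. *)
  have [d dP] : exists d : attach_ray, forall a, code a = n -> Some (inr a) = d.
    have [[a an]|nocode] := pselect (exists a, code a = n).
      by exists (Some (inr a)) => b bn; rewrite (@code_inj a b) // an bn.
    by exists None => a an; case: nocode; exists a.
  (* For [n = 0] the predecessor is [0] itself; this is harmless, as the list need only cover the
     neighbours. *)
  exists (Some (inl n.+1)), (Some (inl n.-1)), d => -[[m|a]|] /=.
  + by case=> ->; right; [left | right; left].
  + by move/dP; do 3 right.
  + by left.
- case=> [[n|a]|] //= _ K f [_ fadj] c cr closed.
  elim: n => [|n IHn]; first exact: adj_sym.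
  by apply: (closed _ _ _ _ IHn); apply/fadj => //=; right.
- case=> [[n|a]|] /=; last by left.
  + by right; exists (Some (inl n.+1)); split=> //=; right.
  + by right; exists (Some (inl (code a))).
Qed.

End AttachRay.

Theorem theorem5 :
  exists sigma : sentence,
    forall G : graph, models G sigma <-> countable [set: G].
Proof.
exists countable_sentence => G; split.
- case/models_countable_sentence=> H [f [[f_inj _] [p [r]]]].
  move/ray_like_countable/countable_injP=> [g g_inj].
  apply/countable_injP; exists (g \o f) => x y _ _ /= gxy.
  by apply: f_inj; apply: g_inj gxy; rewrite in_setT.
- case/countable_injP=> code code_inj.
  have {}code_inj : injective code.
    by move=> x y; apply: code_inj; rewrite in_setT.
  apply/models_countable_sentence; exists (attach_ray code), (Some \o inr).
  split; first exact: embedding_attach_ray.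
  by exists None, (Some (inl 0)); apply: attach_ray_ray_like.
Qed.
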